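(* Let $n_1,\ldots,n_k$ be positive integers, let $\sigma$ be a permutation of $\{1,\ldots,k\}$, and let $[U_\sigma]$ be the $\sigma$-tensor permutation matrix $n_1\otimes n_2\otimes\cdots\otimes n_k$. Then for all square matrices $[A_1],[A_2],\ldots,[A_k]$ over $\mathbb{K}$ of dimensions $n_1,n_2,\ldots,n_k$ respectively, $$[U_\sigma]\cdot([A_1]\otimes[A_2]\otimes\cdots\otimes[A_k])=([A_{\sigma(1)}]\otimes[A_{\sigma(2)}]\otimes\cdots\otimes[A_{\sigma(k)}])\cdot[U_\sigma].$$
   Context: $\mathbb{K}=\mathbb{R}$ or $\mathbb{C}$. The tensor product of matrices $[A]=(A^i_j)$ of size $m\times n$ and $[B]$ of size $p\times r$ is the Kronecker product, i.e. the $mp\times nr$ matrix whose $(i,j)$ block is $A^i_j[B]$. For $\mathbb{K}$-vector spaces $\mathcal{E}_1,\ldots,\mathcal{E}_k$, the $\sigma$-tensor permutation operator is the linear operator $U_\sigma:\mathcal{E}_1\otimes\cdots\otimes\mathcal{E}_k\to\mathcal{E}_{\sigma(1)}\otimes\cdots\otimes\mathcal{E}_{\sigma(k)}$ defined by $U_\sigma(x_1\otimes\cdots\otimes x_k)=x_{\sigma(1)}\otimes\cdots\otimes x_{\sigma(k)}$ for all $x_i\in\mathcal{E}_i$. Let $\mathcal{E}_1,\ldots,\mathcal{E}_k$ have dimensions $n_1,\ldots,n_k$, and let $\mathcal{B}_r=(e_{r1},\ldots,e_{rn_r})$ be a basis of $\mathcal{E}_r$. The $\sigma$-tensor permutation matrix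 $n_1\otimes n_2\otimes\cdots\otimes n_k$ is the matrix of $U_\sigma$ with respect to the pair of bases $(\mathcal{B}_1\otimes\cdots\otimes\mathcal{B}_k,\ \mathcal{B}_{\sigma(1)}\otimes\cdots\otimes\mathcal{B}_{\sigma(k)})$ of the domain and codomain, where a tensor product of ordered bases consists of the tensor products of basis vectors, ordered lexicographically (last index varying fastest). It does not depend on the choice of the bases $\mathcal{B}_r$. *)

(* Defs.v *)
From HB Require Import structures.
From mathcomp Require Import all_boot all_order all_algebra all_fingroup.
From mathcomp Require Import boolp reals complex mxtens.

Set Implicit Arguments.
Unset Strict Implicit.
Unset Printing Implicit Defensive.

Import GRing.Theory.
Local Open Scope ring_scope.

Inductive real_or_complex (R : realType) : fieldType -> Prop :=
| Scalar_real : real_or_complex R R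
| Scalar_complex : real_or_complex R (complex R).

Section TensorProduct.
Variables (K : fieldType) (k : nat).
Implicit Types (E : 'I_k -> vectType K) (s : 'S_k).

Definition multilinear E (W : lmodType K) (f : (forall i, E i) -> W) : Prop :=
  forall (i : 'I_k) (x : forall i, E i), linear (fun v : E i => f (dfwith x v)).

(* A tensor product of E 0, ..., E (k - 1), as characterised by its universal
   property; [tensor_product_exists] below provides one for every E. *)
Record tensor_product E := TensorProduct {
  tp_space :> vectType K;
  tens : (forall i, E i) -> tp_space;
  tens_multilinear : multilinear tens;
  tp_lift : forall (W : lmodType K) (f : (forall i, E i) -> W),
    multilinear f -> {linear tp_space -> W};
  tp_liftE : forall (W : lmodType K) (f : (forall i, E i) -> W)
    (hf : multilinear f) (x : forall i, E i), tp_lift hf (tens x) = f x;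
  tp_lift_uniq : forall (W : lmodType K) (f : (forall i, E i) -> W)
    (hf : multilinear f) (g : {linear tp_space -> W}),
    (forall x, g (tens x) = f x) -> g =1 tp_lift hf
}.

Lemma multilinear_perm E s (T' : tensor_product (fun i => E (s i))) :
  multilinear (fun x : forall i, E i => tens T' (fun i => x (s i))).
Proof.
move=> i x.
have [j ->] : exists j, i = s j by exists (s^-1%g i); rewrite permKV.
have Hw v : (fun l => dfwith x (i := s j) v (s l)) =
            dfwith (fun l => x (s l)) (i := j) v.
  apply: functional_extensionality_dep => l.
  case: (eqVneq j l) v => [<- | njl] v; first by rewrite !dfwith_in.
  by rewrite !dfwith_out // (inj_eq perm_inj).
by move=> a u v; rewrite !Hw tens_multilinear.
Qed.

(* The operator U_s; its defining equation is [tensor_permE]. *)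
Definition tensor_perm E s (T : tensor_product E)
    (T' : tensor_product (fun i => E (s i))) : {linear T -> T'} :=
  tp_lift T (multilinear_perm T').

Lemma tensor_permE E s (T : tensor_product E)
    (T' : tensor_product (fun i => E (s i))) (x : forall i, E i) :
  tensor_perm T T' (tens T x) = tens T' (fun i => x (s i)).
Proof. exact: tp_liftE. Qed.

(* Lexicographic numbering of multi-indices: the i-th coordinate of the t-th
   multi-index is the i-th mixed-radix digit of t, the last one varying
   fastest. *)
Lemma lex_digit_subproof (n : 'I_k -> nat) (t : 'I_(\prod_i n i)) (i : 'I_k) :
  ((t %/ \prod_(j < k | (i < j)%N) n j) %% n i < n i)%N.
Proof.
apply: ltn_pmod; rewrite lt0n; apply/negP => /eqP ni0.
by case: t => t; rewrite (bigD1 i) //= ni0 mul0n.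
Qed.

Definition lex_digit (n : 'I_k -> nat) (t : 'I_(\prod_i n i)) (i : 'I_k) :
  'I_(n i) := Ordinal (lex_digit_subproof t i).

Definition tens_basis E (T : tensor_product E) (n : 'I_k -> nat)
    (B : forall i, (n i).-tuple (E i)) : (\prod_i n i).-tuple T :=
  [tuple tens T (fun i => tnth (B i) (lex_digit t i)) | t < \prod_i n i].

End TensorProduct.

(* Matrices act on column vectors: column j holds the coordinates in C of the
   image of the j-th vector of B.  (The library's [mxof] is the transpose.) *)
Definition matrix_of (K : fieldType) (V W : vectType K) (p q : nat)
    (B : p.-tuple V) (C : q.-tuple W) (f : {linear V -> W}) : 'M[K]_(q, p) :=
  \matrix_(i, j) coord C i (f (tnth B j)).

Definition tensor_perm_mx (K : fieldType) (k : nat) (n : 'I_k -> nat)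
    (s : 'S_k) (E : 'I_k -> vectType K) (B : forall i, (n i).-tuple (E i))
    (T : tensor_product E) (T' : tensor_product (fun i => E (s i))) :
  'M[K]_(\prod_i n (s i), \prod_i n i) :=
  matrix_of (tens_basis T B) (tens_basis T' (fun i => B (s i)))
    (tensor_perm T T').

(* A 0 *t (A 1 *t (... *t A (k - 1))), with [tensmx] the binary Kronecker
   product; the casts only rewrite the sizes as products over 'I_k. *)
Fixpoint kronmx (K : fieldType) (k : nat) :
    forall m n : 'I_k -> nat, (forall i, 'M[K]_(m i, n i)) ->
      'M[K]_(\prod_i m i, \prod_i n i) :=
  match k with
  | 0 => fun m n _ => const_mx 1
  | k'.+1 => fun (m n : 'I_k'.+1 -> nat) A =>
      castmx (esym (big_ord_recl k' m),
              esym (big_ord_recl k' n))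
        (tensmx (A ord0) (kronmx (fun i : 'I_k' => A (lift ord0 i))))
  end.

Section Existence.
Variables (K : fieldType) (k : nat) (E : 'I_k -> vectType K).

Let idx : finType := {dffun forall i : 'I_k, 'I_(\dim {:E i})}.
Let b i (a : 'I_(\dim {:E i})) : E i := tnth (vbasis {:E i}) a.
Let bs (p : idx) : forall i, E i := fun i => b (p i).

Lemma coord_vbasis_delta i (a c : 'I_(\dim {:E i})) :
  coord (vbasis {:E i}) a (b c) = (c == a)%:R.
Proof.
by rewrite /b (tnth_nth 0) coord_free ?(basis_free (vbasisP _)) // eq_sym.
Qed.

Lemma dfwith_dfwith (x : forall i, E i) i (u v : E i) :
  dfwith (dfwith x u) v = dfwith x v.
Proof.
apply: functional_extensionality_dep => j.
case: (eqVneq i j) u v => [<- | nij] u v; first by rewrite !dfwith_in.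
by rewrite !dfwith_out.
Qed.

Lemma dfwith_id (x : forall i, E i) i : dfwith x (x i) = x.
Proof.
apply: functional_extensionality_dep => j.
by case: (eqVneq i j) => [<- | nij]; rewrite ?dfwith_in ?dfwith_out.
Qed.

Lemma multilinear_ext (W : lmodType K) (f g : (forall i, E i) -> W) :
  multilinear f -> multilinear g -> (forall p, f (bs p) = g (bs p)) ->
  f =1 g.
Proof.
move=> hf hg hb x.
suff H m (y : forall i, E i) :
    (forall i : 'I_k, (m <= i)%N -> exists a, y i = b a) -> f y = g y.
  by apply: (H k) => i; rewrite leqNgt ltn_ord.
elim: m y => [|m IH] y hy.
  have ha i : {a | y i = b a} by apply: cid; exact: hy.
  have -> : y = bs (finfun (fun i => projT1 (ha i))).
    apply: functional_extensionality_dep => i.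
    by rewrite /bs ffunE; exact: (projT2 (ha i)).
  exact: hb.
case: (ltnP m k) => hm; last first.
  by apply: IH => i /(leq_trans hm); rewrite leqNgt ltn_ord.
pose i0 := Ordinal hm.
have lin (h : (forall i, E i) -> W) : multilinear h ->
    h y = \sum_a coord (vbasis {:E i0}) a (y i0) *: h (dfwith y (b a)).
  move=> hh.
  pose L := HB.pack (fun v : E i0 => h (dfwith y v))
    (GRing.isLinear.Build K (E i0) W *:%R _ (hh i0 y)) : {linear E i0 -> W}.
  rewrite -[in LHS](dfwith_id y i0) -[LHS]/(L (y i0)).
  rewrite [in LHS](coord_vbasis (memvf (y i0))) linear_sum.
  by apply: eq_bigr => a _; rewrite linearZ /= /b (tnth_nth 0).
rewrite (lin f hf) (lin g hg); apply: eq_bigr => a _; congr (_ *: _).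
apply: IH => i hi.
case: (eqVneq i0 i) => [<- | ni]; first by exists a; rewrite dfwith_in.
rewrite dfwith_out //; apply: hy; rewrite ltn_neqAle hi andbT.
by apply: contra ni => /eqP mi; apply/eqP/val_inj.
Qed.

Let V : vectType K := {ffun idx -> K^o}.

Let tensV (x : forall i, E i) : V :=
  [ffun p : idx => \prod_i coord (vbasis {:E i}) (p i) (x i)].

Lemma tensV_multilinear : multilinear tensV.
Proof.
move=> i x a u v; apply/ffunP => p; rewrite !ffunE !(bigD1 i (P := xpredT)) //=.
rewrite !dfwith_in linearP.
have e (w : E i) :
    \prod_(j | j != i) coord (vbasis {:E j}) (p j) (dfwith x w j) =
           \prod_(j | j != i) coord (vbasis {:E j}) (p j) (x j).
  by apply: eq_bigr => j ji; rewrite dfwith_out // eq_sym.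
by rewrite !e mulrDl -mulrA.
Qed.

Lemma tensV_bs p : tensV (bs p) = [ffun q => (q == p)%:R].
Proof.
apply/ffunP => q; rewrite !ffunE.
under eq_bigr do rewrite coord_vbasis_delta.
case: eqVneq => [-> | nqp]; first by rewrite big1 // => i _; rewrite eqxx.
have [i ni] : exists i, p i != q i.
  apply/existsP; apply: contraR nqp; rewrite negb_exists => /forallP h.
  by apply/eqP/ffunP => i; apply/eqP; rewrite eq_sym; move: (h i); rewrite negbK.
by rewrite (bigD1 i) //= (negbTE ni) mul0r.
Qed.

Section Lift.
Variables (W : lmodType K) (f : (forall i, E i) -> W).

Let liftV (t : V) : W := \sum_p t p *: f (bs p).

Fact liftV_linear : linear liftV.
Proof.
move=> a u v; rewrite /liftV scaler_sumr -big_split; apply: eq_bigr => p _ /=.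
by rewrite !ffunE scalerDl scalerA.
Qed.

Definition lift_lin : {linear V -> W} :=
  HB.pack liftV (GRing.isLinear.Build K V W *:%R liftV liftV_linear).

Lemma lift_lin_bs p : lift_lin (tensV (bs p)) = f (bs p).
Proof.
rewrite /= /liftV tensV_bs (bigD1 p) //= ffunE eqxx scale1r big1 ?addr0 //.
by move=> q qp; rewrite ffunE (negbTE qp) scale0r.
Qed.

Lemma lift_linE : multilinear f -> forall x, lift_lin (tensV x) = f x.
Proof.
move=> hf; apply: multilinear_ext => // [|p]; last exact: lift_lin_bs.
by move=> i x a u v; rewrite tensV_multilinear linearP.
Qed.

Lemma lift_lin_uniq (g : {linear V -> W}) :
  (forall x, g (tensV x) = f x) -> g =1 lift_lin.
Proof.
move=> hg t.
have {1}-> : t = \sum_p t p *: tensV (bs p).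
  apply/ffunP => q; rewrite sum_ffunE (bigD1 q) //= ffunE tensV_bs ffunE eqxx.
  rewrite big1 => [|p pq]; first by rewrite addr0 [RHS]mulr1.
  by rewrite ffunE tensV_bs ffunE eq_sym (negbTE pq) scaler0.
rewrite linear_sum /= /liftV; apply: eq_bigr => p _.
by rewrite linearZ /= hg.
Qed.

End Lift.

Lemma tensor_product_exists : inhabited (tensor_product E).
Proof.
exact: inhabits (@TensorProduct K k E V tensV tensV_multilinear
  (fun W f _ => lift_lin f) (fun W f hf => lift_linE hf)
  (fun W f _ g hg => lift_lin_uniq hg)).
Qed.

End Existence.

(* Main.v *)
Require Import Defs.
From mathcomp Require Import all_boot all_order all_algebra all_fingroup.
From mathcomp Require Import reals.
From mathcomp Require Import mxtens.

Local Open Scope ring_scope.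

(** Numbering multi-indices lexicographically turns both sides into products
    of scalars.  The [(p, q)] entry of a Kronecker product is the product over
    [l] of the entries of the factors at the [l]-th digits of [p] and [q]
    ([kronmxE]).  On the basis tensors, the operator [U_s] only shuffles the
    digits: it sends the [q]-th one to the one numbered [tau q], whose [l]-th
    digit is the [s l]-th digit of [q].  Since the basis tensors of the
    codomain are linearly independent ([tens_basis_free]), the matrix of [U_s]
    is therefore the permutation matrix of the bijection [tau]
    ([tensor_perm_mxE]).  Conjugating by it relabels the entries, and the
    theorem reduces to

      [\prod_l A l (digit p l) (digit q l) =
       \prod_l A (s l) (digit p (s l)) (digit q (s l))],

    a reindexing of the product along [s]. *)

Import GRing.Theory.

(** The index pair that [tensmx] uses when the Kronecker product peels off its
    first factor; relating it to digits is what links [kronmx] to [lex_digit]. *)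
Definition lex_split {k : nat} {n : 'I_k.+1 -> nat} (t : 'I_(\prod_i n i)) :
    'I_(n ord0) * 'I_(\prod_(i < k) n (lift ord0 i)) :=
  mxtens_unindex (cast_ord (big_ord_recl k n) t).

Lemma lex_splitE {k : nat} {n : 'I_k.+1 -> nat} e (t : 'I_(\prod_i n i)) :
  mxtens_unindex (cast_ord e t) = lex_split t.
Proof. by congr mxtens_unindex; apply: val_inj. Qed.

Lemma lex_digit_ord0 {k : nat} {n : 'I_k.+1 -> nat} (t : 'I_(\prod_i n i)) :
  lex_digit t ord0 = (lex_split t).1.
Proof.
apply: val_inj => /=.
have -> : (\prod_(j < k.+1 | 0 < j) n j = \prod_(i < k) n (lift ord0 i))%N.
  by rewrite big_mkcond big_ord_recl /= mul1n.
by rewrite modn_small // (valP (lex_split t).1).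
Qed.

(** The digits after the first only see the remainder modulo the product [P]
    of the later radices, because the place value of digit [i] times its radix
    divides [P]. *)
Lemma lex_digit_lift {k : nat} {n : 'I_k.+1 -> nat} (t : 'I_(\prod_i n i))
    (i : 'I_k) :
  lex_digit t (lift ord0 i) = lex_digit (lex_split t).2 i.
Proof.
apply: val_inj => /=.
have -> : (\prod_(j < k.+1 | bump 0 i < j) n j =
           \prod_(j < k | i < j) n (lift ord0 j))%N.
  by rewrite [LHS]big_mkcond big_ord_recl /= mul1n [RHS]big_mkcond.
rewrite !modn_divl modn_dvdm //.
rewrite [X in (_ %| X)%N](bigD1 i) //= dvdn_mul //.
rewrite [X in (_ %| X)%N](bigID (fun j : 'I_k => (i < j)%N)) /=.
have -> : (\prod_(j < k | (j != i) && (i < j)) n (lift ord0 j) =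
           \prod_(j < k | i < j) n (lift ord0 j))%N.
  by apply: eq_bigl => j; rewrite -(inj_eq val_inj) /=; case: ltngtP.
exact: dvdn_mulr.
Qed.

Lemma lex_digit_inj {k : nat} {n : 'I_k -> nat} (t u : 'I_(\prod_i n i)) :
  (forall i, lex_digit t i = lex_digit u i) -> t = u.
Proof.
elim: k n t u => [|k IH] n t u htu.
  by apply: val_inj; case: t u {htu} => [t ht] [u hu] /=;
     move: ht hu; rewrite big_ord0; case: t u => [|?] [|?].
apply: (can_inj (@cast_ordK _ _ (big_ord_recl k n))).
apply: (can_inj (@mxtens_unindexK _ _)).
rewrite !lex_splitE [LHS]surjective_pairing [RHS]surjective_pairing.
rewrite -!lex_digit_ord0 htu; congr (_, _).
by apply: IH => i; rewrite -!lex_digit_lift htu.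
Qed.

Lemma lex_digit_surj {k : nat} {n : 'I_k -> nat} (a : forall i, 'I_(n i)) :
  exists t : 'I_(\prod_i n i), forall i, lex_digit t i = a i.
Proof.
elim: k n a => [|k IH] n a.
  have h0 : (0 < \prod_(i < 0) n i)%N by rewrite big_ord0.
  by exists (Ordinal h0) => -[].
have [t ht] := IH _ (fun i => a (lift ord0 i)).
exists (cast_ord (esym (big_ord_recl k n)) (mxtens_index (a ord0, t))) => i.
have hs : lex_split (cast_ord (esym (big_ord_recl k n))
                       (mxtens_index (a ord0, t))) = (a ord0, t).
  by rewrite /lex_split cast_ordKV mxtens_indexK.
case: (unliftP ord0 i) => [j ->|->]; last by rewrite lex_digit_ord0 hs.
by rewrite lex_digit_lift hs ht.
Qed.

Lemma kronmxE {K : fieldType} {k : nat} {m n : 'I_k -> nat}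
    (A : forall i, 'M[K]_(m i, n i)) p q :
  kronmx A p q = \prod_i A i (lex_digit p i) (lex_digit q i).
Proof.
elim: k m n A p q => [|k IH] m n A p q; first by rewrite mxE big_ord0.
rewrite castmxE mxE IH [RHS]big_ord_recl !lex_splitE !lex_digit_ord0.
by congr (_ * _); apply: eq_bigr => i _; rewrite !lex_digit_lift.
Qed.

Lemma multilinear_prod_coord {K : fieldType} {k : nat} {E : 'I_k -> vectType K}
    {n : 'I_k -> nat} (B : forall i, (n i).-tuple (E i))
    (a : forall i, 'I_(n i)) :
  multilinear (fun x : forall i, E i =>
    (\prod_i coord (B i) (a i) (x i) : K^o)).
Proof.
move=> i x c u v; rewrite /= !(bigD1 i (P := xpredT)) //= !dfwith_in linearP.
have e (w : E i) :
    \prod_(j | j != i) coord (B j) (a j) (dfwith x w j) =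
    \prod_(j | j != i) coord (B j) (a j) (x j).
  by apply: eq_bigr => j ji; rewrite dfwith_out // eq_sym.
by rewrite !e mulrDl -mulrA.
Qed.

(** By the universal property, the product of the [t]-th digit coordinate
    functionals extends to a linear form on the tensor product; it takes the
    value 1 on the [t]-th basis tensor and vanishes on the others. *)
Lemma tens_basis_free {K : fieldType} {k : nat} {E : 'I_k -> vectType K}
    {n : 'I_k -> nat} (B : forall i, (n i).-tuple (E i))
    (T : tensor_product E) :
  (forall i, free (B i)) -> free (tens_basis T B).
Proof.
move=> hB; apply/freeP => c hc t.
pose hf := multilinear_prod_coord B (lex_digit t).
have phiE (u : 'I_(\prod_i n i)) :
    tp_lift T hf (tens_basis T B)`_u = (t == u)%:R.
  rewrite -tnth_nth tnth_mktuple tp_liftE.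
  under eq_bigr => i _ do rewrite (tnth_nth 0) coord_free //.
  have [<-|ntu] := eqVneq t u; first by rewrite big1 // => i _; rewrite eqxx.
  have [i ni] : exists i, lex_digit u i != lex_digit t i.
    apply/existsP; apply: contraR ntu; rewrite negb_exists => /forallP h.
    by apply/eqP/lex_digit_inj => i; apply/esym/eqP/negbNE/h.
  by rewrite (bigD1 i) //= (negbTE ni) mul0r.
have := congr1 (tp_lift T hf) hc; rewrite linear_sum linear0 /= (bigD1 t) //=.
rewrite linearZ /= phiE eqxx big1 ?addr0 => [|u ut].
  by rewrite [_ *: _]mulr1.
by rewrite linearZ /= phiE eq_sym (negbTE ut) scaler0.
Qed.

(** Such a [tau] is injective because [s] reaches every digit position, and the
    two index sets have the same size, so no inverse needs to be constructed
    by transport along [s (s^-1 i) = i]. *)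
Lemma lex_permute_exists {k : nat} (n : 'I_k -> nat) (s : 'S_k) :
  exists2 tau : 'I_(\prod_i n i) -> 'I_(\prod_i n (s i)),
    bijective tau & forall t i, lex_digit (tau t) i = lex_digit t (s i).
Proof.
have ex t : exists u : 'I_(\prod_i n (s i)),
    [forall i, lex_digit u i == lex_digit t (s i)].
  have [u hu] := lex_digit_surj (fun i => lex_digit t (s i)).
  by exists u; apply/forallP => i; apply/eqP/hu.
pose tau t := xchoose (ex t).
have tauE t i : lex_digit (tau t) i = lex_digit t (s i).
  by apply/eqP; move: i; apply/forallP; exact: (xchooseP (ex t)).
exists tau => //; apply: inj_card_bij; last first.
  by rewrite !card_ord [leqRHS](reindex_perm s).
move=> t u tu; apply: lex_digit_inj => i.
by rewrite -(permKV s i) -!tauE tu.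
Qed.

Lemma tensor_perm_mxE {K : fieldType} {k : nat} {n : 'I_k -> nat} {s : 'S_k}
    {E : 'I_k -> vectType K} {B : forall i, (n i).-tuple (E i)}
    (T : tensor_product E) (T' : tensor_product (fun i => E (s i)))
    {tau : 'I_(\prod_i n i) -> 'I_(\prod_i n (s i))} :
  (forall i, free (B i)) ->
  (forall t i, lex_digit (tau t) i = lex_digit t (s i)) ->
  forall p q, tensor_perm_mx B T T' p q = (p == tau q)%:R.
Proof.
move=> hB tauE p q; rewrite mxE tnth_mktuple tensor_permE.
have -> : tens T' (fun i => tnth (B (s i)) (lex_digit q (s i))) =
          (tens_basis T' (fun i => B (s i)))`_(tau q).
  rewrite -tnth_nth tnth_mktuple; congr tens.
  by apply: boolp.functional_extensionality_dep => i; rewrite tauE.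
by rewrite coord_free 1?eq_sym // tens_basis_free.
Qed.

Theorem theorem0p4p2 (R : realType) (K : fieldType) (hK : real_or_complex R K)
    (k : nat) (n : 'I_k -> nat) (hn : forall i, (0 < n i)%N) (s : 'S_k)
    (E : 'I_k -> vectType K) (B : forall i, (n i).-tuple (E i))
    (hB : forall i, basis_of fullv (B i))
    (T : tensor_product E) (T' : tensor_product (fun i => E (s i)))
    (A : forall i, 'M[K]_(n i)) :
  tensor_perm_mx B T T' *m kronmx A
  = kronmx (fun i => A (s i)) *m tensor_perm_mx B T T'.
Proof.
have hfree i : free (B i) := basis_free (hB i).
have [tau tau_bij tauE] := lex_permute_exists n s.
have UE := tensor_perm_mxE T T' hfree tauE.
apply/matrixP => p' q.
(* Every row number is [tau p], so both sides can be read in column numbers. *)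
have [tau_inv _ tauK] := tau_bij; rewrite -(tauK p'); move: (tau_inv p') => p.
transitivity (kronmx A p q).
  rewrite mxE (bigD1 p) //= UE eqxx mul1r [X in _ + X]big1 ?addr0 // => r rp.
  by rewrite UE (inj_eq (bij_inj tau_bij)) eq_sym (negbTE rp) mul0r.
transitivity (kronmx (fun i => A (s i)) (tau p) (tau q)); last first.
  rewrite mxE (bigD1 (tau q)) //= UE eqxx mulr1.
  rewrite [X in _ + X]big1 ?addr0 // => r rq.
  by rewrite UE (negbTE rq) mulr0.
rewrite !kronmxE [LHS](reindex_perm s).
by apply: eq_bigr => l _; rewrite !tauE.
Qed.
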